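(* Let $2\leq p\leq\infty$, and let $E$ be a locally convex space with the Rosenthal property. Then every coarse $p$-limited subset of $E$ is weakly sequentially precompact.
   Context: All locally convex spaces are Hausdorff, over $\mathbb{F}\in\{\mathbb{R},\mathbb{C}\}$; $\omega=\{0,1,2,\dots\}$. A sequence $\{a_n\}_{n\in\omega}$ in $E$ is equivalent to the standard unit basis $\{e_n\}_{n\in\omega}$ of $\ell_1$ if there is a linear topological isomorphism $R$ from $\overline{\mathrm{span}}\{a_n\}_{n\in\omega}$ onto a subspace of $\ell_1$ such that $R(a_n)=e_n$ for every $n\in\omega$. $E$ has the Rosenthal property if every bounded sequence in $E$ has a subsequence which either (1) is Cauchy in the weak topology, or (2) is equivalent to the standard unit basis of $\ell_1$. A non-empty subset $A$ of $E$ is coarse $p$-limited if $T(A)$ is relatively compact for every continuous linear map $T:E\to\ell_p$ (or $T:E\to c_0$ if $p=\infty$). $A$ is weakly sequentially precompact if each sequence in $A$ has a weakly Cauchy subsequence. *)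

(* Defs.v *)
From HB Require Import structures.
From mathcomp Require Import all_boot all_order all_algebra.
From mathcomp Require Import all_classical all_reals all_analysis.
From mathcomp Require Import finmap ess_sup_inf complex.

Set Implicit Arguments.
Unset Strict Implicit.
Unset Printing Implicit Defensive.

Import Order.TTheory GRing.Theory Num.Theory.
Import numFieldNormedType.Exports.

Local Open Scope classical_set_scope.
Local Open Scope ring_scope.

(* Every space below is over [scalar_field R k], i.e. over the real numbers or
   over the complex numbers.  Norms in a [normedModType K] are K-valued, hence
   the embedding [of_real]; [modulus] is the real-valued absolute value. *)
Inductive scalars := Reals | Complexes.

Definition scalar_field (R : realType) (k : scalars) : numFieldType :=
  match k with Reals => R | Complexes => R[i] end.

Definition of_real (R : realType) (k : scalars) : R -> scalar_field R k :=
  match k return R -> scalar_field R k with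
  | Reals => fun r => r
  | Complexes => fun r => real_complex R r
  end.

Definition modulus (R : realType) (k : scalars) : scalar_field R k -> R :=
  match k return scalar_field R k -> R with
  | Reals => fun x => `|x|
  | Complexes => fun z => ComplexField.Normc.normc z
  end.

Section scalar_theory.
Context (R : realType) (k : scalars).
Local Notation K := (scalar_field R k).
Implicit Types (r s : R) (x y : K).

Lemma of_realD r s : of_real k (r + s) = of_real k r + of_real k s.
Proof. by case: k => //=; rewrite rmorphD. Qed.

Lemma of_realM r s : of_real k (r * s) = of_real k r * of_real k s.
Proof. by case: k => //=; rewrite rmorphM. Qed.

Lemma of_real0 : of_real k (0 : R) = 0.
Proof. by case: k. Qed.

Lemma of_real_inj : injective (@of_real R k).
Proof. by case: k => //= r s []. Qed.

Lemma ler_of_real r s : (of_real k r <= of_real k s) = (r <= s).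
Proof. by case: k => //=; rewrite lecE /= eqxx. Qed.

Lemma of_real_modulus x : of_real k (modulus x) = `|x|.
Proof. by case: k x. Qed.

Lemma modulus_ge0 x : 0 <= modulus x.
Proof. by rewrite -ler_of_real of_real_modulus of_real0. Qed.

Lemma modulusD x y : modulus (x + y) <= modulus x + modulus y.
Proof. by rewrite -ler_of_real of_realD !of_real_modulus ler_normD. Qed.

Lemma modulusM x y : modulus (x * y) = modulus x * modulus y.
Proof. by apply: of_real_inj; rewrite of_realM !of_real_modulus normrM. Qed.

Lemma modulus0_eq0 x : modulus x = 0 -> x = 0.
Proof.
by move=> x0; apply/eqP; rewrite -normr_eq0 -of_real_modulus x0 of_real0.
Qed.

Lemma modulus0 : modulus (0 : K) = 0.
Proof. by apply: of_real_inj; rewrite of_real_modulus of_real0 normr0. Qed.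

End scalar_theory.

Section ell.
Context (R : realType) (k : scalars) (p : \bar R).
Local Notation K := (scalar_field R k).
Implicit Types (x y : nat -> K^o).

(* An L^p-norm for the counting measure on nat, i.e. (sum_n |x_n|^p)^(1/p) for
   finite p (see [Lnorm_counting]) and sup_n |x_n| for p = +oo. *)
Definition seq_norm x : \bar R :=
  Lnorm counting p (fun n => (modulus (x n))%:E).

Hypothesis p1 : (1 <= p)%E.

Let p0 : (0 < p)%E.
Proof. exact: lt_le_trans p1. Qed.

Let counting_nat_gt0 : (0 < @counting nat R [set: nat])%E.
Proof. by rewrite /counting asboolF//; exact: infinite_nat. Qed.

Lemma seq_norm_le (f g : nat -> R) : (forall n, 0 <= f n <= g n) ->
  (Lnorm counting p (EFin \o f) <= Lnorm counting p (EFin \o g))%E.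
Proof.
move=> fg; have afg n : (`|(f n)%:E| <= `|(g n)%:E|)%E.
  by have /andP[f0 fgn] := fg n; rewrite lee_fin !ger0_norm// (le_trans f0).
rewrite unlock; case: p p0 => [r||//]; last first.
  move=> _; rewrite counting_nat_gt0; apply: le_ess_sup.
  exact: nearW.
rewrite lte_fin => r0.
have leP (a b : \bar R) (s : R) : 0 <= s -> (0 <= a <= b)%E ->
    (a `^ s <= b `^ s)%E.
  move=> s0 /andP[a0 ab]; apply: gt0_ler_poweR => //.
    by rewrite in_itv/= a0 leey.
  by rewrite in_itv/= (le_trans a0)// leey.
apply: (leP _ _ _); first by rewrite invr_ge0 ltW.
apply/andP; split; first by apply: integral_ge0 => *; exact: poweR_ge0.
apply: ge0_le_integral => //; [by move=> *; exact: poweR_ge0| move=> n _].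
by apply: (leP _ _ _); [exact: ltW|rewrite abse_ge0; exact: afg].
Qed.

Lemma seq_normD x y : (seq_norm (x + y)%R <= seq_norm x + seq_norm y)%E.
Proof.
apply: le_trans (eminkowski _ _ _ p1) => //.
by apply: seq_norm_le => n /=; rewrite modulus_ge0 modulusD.
Qed.

Lemma seq_normZ a x : seq_norm (a *: x) = ((modulus a)%:E * seq_norm x)%E.
Proof.
rewrite /seq_norm unlock.
have E n : (`|(modulus ((a *: x) n))%:E| =
            (modulus a)%:E * `|(modulus (x n))%:E|)%E.
  by rewrite (modulusM a (x n)) EFinM abseM gee0_abs ?lee_fin ?modulus_ge0.
case: p p0 => [r||//]; last first.
  move=> _; rewrite counting_nat_gt0 -ess_supZl ?modulus_ge0//.
  by apply/eq_ess_sup/nearW => n; exact: E.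
rewrite lte_fin => r0.
rewrite (eq_integral (fun n =>
    ((modulus a)%:E `^ r * `|(modulus (x n))%:E| `^ r)%E)); last first.
  by move=> n _; rewrite E poweRM ?abse_ge0 ?lee_fin ?modulus_ge0.
rewrite ge0_integralZl//; do ?by move=> *; exact: poweR_ge0.
rewrite poweRM; first last.
- by apply: integral_ge0 => *; exact: poweR_ge0.
- exact: poweR_ge0.
by rewrite !poweR_EFin -powRrM mulfV ?gt_eqF// powRr1 ?modulus_ge0.
Qed.

Lemma seq_norm_eq0 x : seq_norm x = 0%E -> x = 0.
Proof.
move=> /Lnorm_eq0_eq0 => /(_ _ p0) [//|A [_ A0 xA]].
apply/funext => n; apply: contrapT => xn0.
have An : A n by apply: xA => /=; apply: contra_not xn0 => /(_ I) [] /modulus0_eq0.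
have : (counting [set n] <= @counting nat R A)%E.
  by apply: le_measure; [exact: mem_set|exact: mem_set|move=> _ ->].
rewrite A0.
by rewrite /counting asboolT ?fset_set1// cardfs1 lee_fin ler10.
Qed.

Lemma seq_norm0 : seq_norm 0 = 0%E.
Proof. by rewrite -(scale0r (0 : nat -> K^o)) seq_normZ modulus0 mul0e. Qed.

(* [p1] is a dummy argument that lets the instances below be inferred *)
Definition ellp of (1 <= p)%E : {pred nat -> K^o} :=
  [pred x | (seq_norm x < +oo)%E].

Record ell := Ell { seq_of :> nat -> K^o; seq_ofP : seq_of \in ellp p1 }.

Lemma ellp_submod_closed : submod_closed (ellp p1).
Proof.
split; first by rewrite inE seq_norm0.
move=> a x y; rewrite !inE => xoo yoo.
rewrite (le_lt_trans (seq_normD _ _))// seq_normZ lte_add_pinfty//.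
by rewrite lte_mul_pinfty// lee_fin modulus_ge0.
Qed.

HB.instance Definition _ :=
  GRing.isSubmodClosed.Build K (nat -> K^o) (ellp p1) ellp_submod_closed.

HB.instance Definition _ := [isSub for seq_of].
HB.instance Definition _ := [Choice of ell by <:].
HB.instance Definition _ := [SubChoice_isSubLmodule of ell by <:].

Let ell_norm (x : ell) : K := of_real k (fine (seq_norm x)).

Let seq_norm_fin (x : ell) : seq_norm x \is a fin_num.
Proof. by rewrite ge0_fin_numE ?Lnorm_ge0//; exact: (seq_ofP x). Qed.

Let ell_normD (x y : ell) : ell_norm (x + y) <= ell_norm x + ell_norm y.
Proof.
rewrite -of_realD ler_of_real -fineD// fine_le ?fin_numD ?seq_norm_fin//.
exact: seq_normD.
Qed.

Let ell_normZ a (x : ell) : ell_norm (a *: x) = `|a| * ell_norm x.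
Proof. by rewrite /ell_norm seq_normZ fineM// of_realM of_real_modulus. Qed.

Let ell_norm_eq0 (x : ell) : ell_norm x = 0 -> x = 0.
Proof.
rewrite -of_real0 => /of_real_inj/eqP; rewrite fine_eq0// => /eqP.
by move=> /seq_norm_eq0 x0; exact: val_inj.
Qed.

HB.instance Definition _ :=
  Lmodule_isNormed.Build K ell ell_normD ell_normZ ell_norm_eq0.

Lemma ell_normE (x : ell) : `|x| = of_real k (fine (seq_norm x)).
Proof. by []. Qed.

End ell.
Arguments ell {R} k {p} p1.

Section c0.
Context (R : realType) (k : scalars).
Local Notation K := (scalar_field R k).
Local Notation ell_oo := (@ell R k +oo%E (leey 1%E)).

Definition null_seq : {pred ell_oo} :=
  mem [set x : ell_oo | (x : nat -> K^o) @ \oo --> (0 : K^o)].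

Record c0 := C0 { ell_of :> ell_oo; ell_ofP : ell_of \in null_seq }.

Lemma null_seq_submod_closed : submod_closed null_seq.
Proof.
split; first by apply: mem_set; exact: cvg_cst.
move=> a x y /set_mem/= x0 /set_mem/= y0; apply: mem_set => /=.
have -> : (0 : K^o) = a *: 0 + 0 by rewrite scaler0 addr0.
by apply: cvgD => //; apply: cvgZr.
Qed.

HB.instance Definition _ :=
  GRing.isSubmodClosed.Build K ell_oo null_seq null_seq_submod_closed.

HB.instance Definition _ := [isSub for ell_of].
HB.instance Definition _ := [Choice of c0 by <:].
HB.instance Definition _ := [SubChoice_isSubLmodule of c0 by <:].

Let c0_norm (x : c0) : K := `|ell_of x|.

Let c0_normD (x y : c0) : c0_norm (x + y) <= c0_norm x + c0_norm y.
Proof. exact: ler_normD. Qed.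

Let c0_normZ a (x : c0) : c0_norm (a *: x) = `|a| * c0_norm x.
Proof. exact: normrZ. Qed.

Let c0_norm_eq0 (x : c0) : c0_norm x = 0 -> x = 0.
Proof. by move=> /normr0_eq0 x0; exact: val_inj. Qed.

HB.instance Definition _ :=
  Lmodule_isNormed.Build K c0 c0_normD c0_normZ c0_norm_eq0.

Lemma c0_normE (x : c0) : `|x| = `|ell_of x|.
Proof. by []. Qed.

End c0.

Section locally_convex.
Context (R : realType) (k : scalars).
Local Notation K := (scalar_field R k).
Context (E : tvsType K).

Record dual := Dual {
  functional :> {linear E -> K^o}; functional_continuous : continuous functional
}.

(* E with the weak topology and its uniformity, through the canonical embedding
   of E into the product of copies of K indexed by the dual *)
Definition weak := initial_topology
  (fun x : E => (fun f : dual => f x) : prod_topology (fun _ : dual => K^o)).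

Definition weakly_cauchy (x : nat -> E) := cauchy ((x : nat -> weak) @ \oo).

Definition subsequence (T : Type) (y x : nat -> T) :=
  exists2 phi : nat -> nat, {homo phi : m n / (m < n)%N} & y = x \o phi.

(* von Neumann boundedness: A is absorbed by every neighbourhood of 0 *)
Definition tvs_bounded (A : set E) := forall U : set E, nbhs 0 U ->
  exists2 r : K, 0 < r & A `<=` [set r *: u | u in U].

Definition seq_span (a : nat -> E) : set E :=
  [set x | exists n (c : nat -> K), x = \sum_(i < n) c i *: a i].

(* f restricted to S is a linear homeomorphism onto f(S); the values of f
   outside S are irrelevant *)
Definition top_linear_embedding (F : tvsType K) (S : set E) (f : E -> F) :=
  [/\ forall (c : K) x y, S x -> S y -> f (c *: x + y) = c *: f x + f y,
      {within S, continuous f} &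
      exists2 g : F -> E, (forall x, S x -> g (f x) = x)
                        & {within f @` S, continuous g}].

Definition equiv_ell1_basis (a : nat -> E) :=
  exists2 f : E -> ell k (lexx (1%:E : \bar R)),
    top_linear_embedding (closure (seq_span a)) f &
    forall n m, f (a n) m = (m == n)%:R.

Definition rosenthal_property := forall a : nat -> E, tvs_bounded (range a) ->
  exists2 b, subsequence b a & weakly_cauchy b \/ equiv_ell1_basis b.

Definition coarse_limited (p : \bar R) (p1 : (1 <= p)%E) (A : set E) :=
  A !=set0 /\
  if p == +oo%E then
    forall T : {linear E -> c0 R k}, continuous T -> precompact (T @` A)
  else
    forall T : {linear E -> ell k p1}, continuous T -> precompact (T @` A).

Definition weakly_sequentially_precompact (A : set E) :=
  forall a : nat -> E, (forall n, A (a n)) ->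
  exists2 b, subsequence b a & weakly_cauchy b.

End locally_convex.

Lemma ge1_of_ge2 (R : realType) (p : \bar R) : (2%:E <= p)%E -> (1 <= p)%E.
Proof. exact/le_trans/lee1n. Qed.

(* Main.v *)
Require Import Defs.
From HB Require Import structures.
From mathcomp Require Import finmap.
From mathcomp Require Import all_boot all_order all_algebra.
From mathcomp Require Import all_classical all_reals all_analysis.
From mathcomp Require Import complex ess_sup_inf ring lra.

Set Implicit Arguments.
Unset Strict Implicit.
Unset Printing Implicit Defensive.

Import Order.TTheory GRing.Theory Num.Theory.
Import numFieldNormedType.Exports.

Local Open Scope classical_set_scope.
Local Open Scope ring_scope.

(** The argument has two halves, which share one obstruction.

    A coarse p-limited set A cannot contain a diagonal sequence: if real-linear
    functionals f_0, f_1, ... on E are square-summably dominated by a continuous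
    seminorm q, i.e. sum_i f_i(x)^2 <= q(x)^2, then no sequence a_n of A
    satisfies f_n(a_n) >= 1 for all n [coarse_limited_diagonal].  Indeed, after
    complexification the f_i are the coordinates of a continuous operator from E
    to l_2, hence to l_p for p >= 2 and to c_0; the image of A being relatively
    compact there, some T(a_m) is close to T(a_n) for infinitely many n, although
    the n-th coordinate of T(a_m) tends to 0 and that of T(a_n) does not.

    First half: sequences in A are bounded [coarse_limited_bounded].  If a
    continuous seminorm q were unbounded on A, pick a_n in A with
    q(a_n) >= 2^(n+1) and, by Hahn-Banach, functionals f_n dominated by
    q / 2^(n+1) that attain this bound at a_n: they are a diagonal family.

    By the Rosenthal property the sequence then has a weakly Cauchy subsequence,
    which is the claim, or a subsequence b equivalent to the basis of l_1.

    Second half: a copy of the basis of l_1 is excluded.  The functionals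
    biorthogonal to b have to be extended to E so that they stay square-summable.
    The classical proof sends b to the Rademacher functions in L_oo, extends by
    injectivity of L_oo, and passes to L_2.  Here this is condensed into one
    application of Hahn-Banach [extend_l2]: on the space of E-valued sequences v,
    take the seminorm sup_n of the mean of q(sum_{i<n} eps_i v_i) over all signs
    eps.  It dominates sum_i t_i at the sequences t_i b_i, because q is at least
    the l_1-norm on the span of b, and it is at most |c|_2 q(x) at the sequences
    c_i x, because the mean square of sum_i eps_i c_i is sum_i c_i^2.  So a
    functional G below it with G(t_i b_i) >= sum_i t_i exists, and the components
    of G form a diagonal family for b. *)

(** * Sublinear functionals and the Hahn-Banach theorem *)

Section hahn_banach.
Context (R : realType) (V : lmodType R).
Implicit Types (P Q h : V -> R) (C : set (V * R)).

(** Homogeneity is only required as an inequality, which is what the infimum and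
    supremum constructions give directly; [sublinearZ] recovers equality. *)
Definition sublinear P :=
  (forall x y, P (x + y) <= P x + P y) /\
  (forall r x, 0 < r -> P (r *: x) <= r * P x).

Lemma sublinear0 P : sublinear P -> P 0 = 0.
Proof.
move=> [_ PZ].
have := PZ 2 0; have := PZ 2^-1 0; rewrite !scaler0 invr_gt0 ltr0Sn.
by move=> /(_ isT) h1 /(_ isT) h2; lra.
Qed.

Lemma sublinearZ P r x : sublinear P -> 0 <= r -> P (r *: x) = r * P x.
Proof.
move=> slP; rewrite le_eqVlt => /predU1P[<-|r0].
  by rewrite scale0r mul0r sublinear0.
have [_ PZ] := slP; apply/le_anti; rewrite PZ //=.
have := PZ r^-1 (r *: x); rewrite invr_gt0 r0 scalerA mulVf ?gt_eqF// scale1r.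
by move=> /(_ isT); rewrite ler_pdivlMl.
Qed.

Lemma sublinear_geN P x : sublinear P -> - P (- x) <= P x.
Proof.
move=> slP; have [PD _] := slP.
by have := PD x (- x); rewrite subrr sublinear0// => ?; lra.
Qed.

(** The common mechanism behind lowering a sublinear functional along a cone and
    taking the infimum of a chain: subadditivity passes to the infimum of a
    family H as soon as the sum of two members is bounded below by a third. *)
Lemma sublinear_inf (H : set (V -> R)) (m : V -> R) :
    H !=set0 -> (forall h x, H h -> m x <= h x) ->
    (forall h1 h2, H h1 -> H h2 ->
      exists2 h, H h & forall x y, h (x + y) <= h1 x + h2 y) ->
    (forall h r, H h -> 0 < r ->
      exists2 h', H h' & forall x, h' (r *: x) <= r * h x) ->
  exists2 Q, sublinear Q & forall h x, H h -> Q x <= h x.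
Proof.
move=> [h0 Hh0] mH HD HZ; pose Q x := inf [set h x | h in H].
have QH h x : H h -> Q x <= h x.
  by move=> Hh; apply: ge_inf; [exists (m x) => _ [g Hg <-]; exact: mH|exists h].
have geQ x r : (forall h, H h -> r <= h x) -> r <= Q x.
  by move=> rH; apply: lb_le_inf; [exists (h0 x); exists h0|move=> _ [h /rH + <-]].
exists Q => //; split=> [x y|r x r0].
  rewrite -lerBlDr; apply: (geQ) => h1 Hh1; rewrite lerBlDr -lerBlDl.
  apply: (geQ) => h2 Hh2; rewrite lerBlDl.
  by have [h Hh hD] := HD _ _ Hh1 Hh2; exact: le_trans (QH _ _ Hh) (hD _ _).
rewrite -ler_pdivrMl//; apply: geQ => h Hh; rewrite ler_pdivrMl//.
by have [h' Hh' h'Z] := HZ _ _ Hh r0; exact: le_trans (QH _ _ Hh') (h'Z _).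
Qed.

Definition cone C := [/\ C (0, 0),
  forall c d, C c -> C d -> C (c.1 + d.1, c.2 + d.2) &
  forall r c, 0 < r -> C c -> C (r *: c.1, r * c.2)].

(** The functional is Q(x) = inf_(c in C) P(x + c.1) - c.2, the largest sublinear
    functional below P whose linear minorants f all satisfy c.2 <= f(c.1) on C. *)
Lemma sublinear_below_cone P C : sublinear P -> cone C ->
    (forall c, C c -> c.2 <= P c.1) ->
  exists2 Q, sublinear Q &
    (forall x, Q x <= P x) /\ forall c, C c -> Q (- c.1) <= - c.2.
Proof.
move=> slP [C0 CD CZ] CP; have [PD PZ] := slP.
pose h (c : V * R) x := P (x + c.1) - c.2.
have [||||Q slQ QH] := @sublinear_inf [set h c | c in C] (fun x => - P (- x)).
- by exists (h (0, 0)); exists (0, 0).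
- move=> _ x [c Cc <-]; rewrite /h.
  have := PD (x + c.1) (- x); rewrite [x + _]addrC addrK => ?.
  by have := CP _ Cc => ?; lra.
- move=> _ _ [c Cc <-] [d Cd <-]; exists (h (c.1 + d.1, c.2 + d.2)).
    by exists (c.1 + d.1, c.2 + d.2) => //; exact: CD.
  move=> x y; rewrite /h /= addrACA.
  by have := PD (x + c.1) (y + d.1) => ?; lra.
- move=> _ r [c Cc <-] r0; exists (h (r *: c.1, r * c.2)).
    by exists (r *: c.1, r * c.2) => //; exact: CZ.
  by move=> x; rewrite /h /= -scalerDr mulrBr lerD2r; exact: PZ.
exists Q => //; split=> [x|c Cc].
  have : Q x <= h (0, 0) x by apply: QH; exists (0, 0).
  by rewrite /h /= addr0 subr0.
have : Q (- c.1) <= h c (- c.1) by apply: QH; exists c.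
by rewrite /h addNr sublinear0// sub0r.
Qed.

Definition ray P a : set (V * R) :=
  [set c | exists2 t, 0 <= t & c = (t *: a, t * P a)].

Lemma cone_ray P a : cone (ray P a).
Proof.
split.
- by exists 0; rewrite ?scale0r ?mul0r.
- move=> _ _ [t t0 ->] [s s0 ->]; exists (t + s); first exact: addr_ge0.
  by rewrite /= scalerDl mulrDl.
- move=> r _ r0 [t t0 ->]; exists (r * t); first exact: mulr_ge0 (ltW r0) t0.
  by rewrite /= scalerA mulrA.
Qed.

Lemma ray_le P a c : sublinear P -> ray P a c -> c.2 <= P c.1.
Proof. by move=> slP [t t0 ->] /=; rewrite sublinearZ. Qed.

Lemma exists_minimal_sublinear P : sublinear P ->
  exists2 Q, sublinear Q & (forall x, Q x <= P x) /\
    forall Q', sublinear Q' -> (forall x, Q' x <= Q x) -> Q' = Q.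
Proof.
move=> slP.
pose T := {Q : V -> R | sublinear Q /\ forall x, Q x <= P x}.
pose below (Q Q' : T) := `[< forall x, sval Q' x <= sval Q x >].
have [||||[Q [slQ QP]] Qmin] := @Zorn T below.
- by move=> Q; apply/asboolP.
- move=> Q1 Q2 Q3 /asboolP Q12 /asboolP Q23; apply/asboolP => x.
  exact: le_trans (Q12 x).
- move=> [Q1 ?] [Q2 ?] /asboolP/= Q12 /asboolP/= Q21; apply: eq_exist.
  by apply/funext => x; apply/le_anti; rewrite Q12 Q21.
- move=> A chainA.
  have [[Q0 AQ0]|/set0P/negP/negPn/eqP A0] := pselect (A !=set0); last first.
    by exists (exist _ P (conj slP (fun x => lexx (P x)))); rewrite A0.
  have [||||Q slQ QA] :=
      @sublinear_inf [set sval Q | Q in A] (fun x => - P (- x)).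
  + by exists (sval Q0); exists Q0.
  + move=> _ x [[Q [slQ QP]] _ <-] /=; apply: le_trans (sublinear_geN _ slQ).
    by rewrite lerN2.
  + move=> _ _ [Q1 AQ1 <-] [Q2 AQ2 <-].
    have [/asboolP Q12|/asboolP Q21] := chainA _ _ AQ1 AQ2.
      exists (sval Q2); first by exists Q2.
      move=> x y; apply: (le_trans ((proj1 (proj1 (svalP Q2))) x y)).
      by rewrite lerD2r.
    exists (sval Q1); first by exists Q1.
    move=> x y; apply: (le_trans ((proj1 (proj1 (svalP Q1))) x y)).
    by rewrite lerD2l.
  + move=> _ r [Q1 AQ1 <-] r0; exists (sval Q1); first by exists Q1.
    by move=> x; exact: (proj2 (proj1 (svalP Q1))).
  have QP x : Q x <= P x.
    apply: le_trans (QA (sval Q0) x _) _; first by exists Q0.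
    exact: (proj2 (svalP Q0)).
  exists (exist _ Q (conj slQ QP)) => Q1 AQ1; apply/asboolP => x /=.
  by apply: QA; exists Q1.
exists Q => //; split=> // Q' slQ' Q'Q.
have Q'P x : Q' x <= P x by exact: le_trans (QP x).
have := Qmin (exist _ Q' (conj slQ' Q'P)).
by move=> /(_ (asboolT Q'Q)) [].
Qed.

(** Lowering P along the ray of x forces P(- x) <= - P(x), so that by minimality P
    is odd; an odd sublinear functional is linear. *)
Lemma minimal_sublinear_linear P : sublinear P ->
    (forall Q, sublinear Q -> (forall x, Q x <= P x) -> Q = P) ->
  scalar P.
Proof.
move=> slP Pmin; have [PD _] := slP.
have PN x : P (- x) = - P x.
  have [Q slQ [QP Qx]] := sublinear_below_cone slP (cone_ray P x)
    (fun c => @ray_le P x c slP).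
  have QE : Q = P by exact: Pmin.
  have := Qx (x, P x); rewrite QE /=.
  have := sublinear_geN x slP => ?.
  move=> h; have {}h : P (- x) <= - P x.
    by apply: h; exists 1; rewrite ?scale1r ?mul1r.
  by apply/eqP; rewrite eq_le h /=; lra.
have PA x y : P (x + y) = P x + P y.
  apply/le_anti; rewrite PD /=.
  by have := PD (- x) (- y); rewrite -opprD !PN -opprD lerN2.
move=> r x y; rewrite PA; congr (_ + _).
have [r0|r0] := leP 0 r; first exact: sublinearZ.
rewrite -[r]opprK scaleNr PN sublinearZ ?mulNr// oppr_ge0; exact: ltW.
Qed.

(** Prescribing lower bounds on a cone of pairs (vector, bound), rather than
    values on a subspace, serves both purposes below: norming a vector (a ray) and
    building the diagonal family of [extend_l2]. *)
Theorem hahn_banach_cone P C : sublinear P -> cone C ->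
    (forall c, C c -> c.2 <= P c.1) ->
  exists f : {scalar V}, (forall x, f x <= P x) /\ forall c, C c -> c.2 <= f c.1.
Proof.
move=> slP coneC CP.
have [Q slQ [QP QC]] := sublinear_below_cone slP coneC CP.
have [f slf [fQ fmin]] := exists_minimal_sublinear slQ.
have linf := minimal_sublinear_linear slf fmin.
pose fL := GRing.isLinear.Build R V R *%R f linf.
pose F : {scalar V} := HB.pack f fL.
exists F; split=> [x|c Cc]; first exact: le_trans (fQ x) (QP x).
rewrite -lerN2 -linearN /=; exact: le_trans (fQ _) (QC _ Cc).
Qed.

Corollary hahn_banach_point P a : sublinear P ->
  exists f : {scalar V}, (forall x, f x <= P x) /\ f a = P a.
Proof.
move=> slP; have [f [fP fa]] := hahn_banach_cone slP (cone_ray P a)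
  (fun c => @ray_le P a c slP).
exists f; split=> //; apply/le_anti; rewrite fP /=.
by apply: (fa (a, P a)); exists 1; rewrite ?scale1r ?mul1r.
Qed.

End hahn_banach.

(** * Square-summable extension of a lower l_1-estimate *)

Section rademacher.
Context (R : realType) (X : lmodType R) (q : X -> R).
Implicit Types (x y : X) (v w : nat -> X) (r : R).

Definition seminorm := (forall x y, q (x + y) <= q x + q y) /\
  (forall r x, q (r *: x) = `|r| * q x).

Lemma seminorm_sublinear : seminorm -> sublinear q.
Proof. by move=> [qD qZ]; split=> // r x r0; rewrite qZ gtr0_norm. Qed.

(** The mean of q(x + sum_{i<n} eps_i v_i) over the 2^n choices of signs eps; the
    recursion on n replaces a sum over sign vectors. *)
Fixpoint sign_mean n x v : R :=
  if n is m.+1 then (sign_mean m (x + v m) v + sign_mean m (x - v m) v) / 2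
  else q x.

Hypothesis semq : seminorm.
Let qD : forall x y, q (x + y) <= q x + q y. Proof. exact: (proj1 semq). Qed.
Let qZ : forall r x, q (r *: x) = `|r| * q x. Proof. exact: (proj2 semq). Qed.

Lemma seminormN x : q (- x) = q x.
Proof. by rewrite -scaleN1r qZ normrN1 mul1r. Qed.

Lemma seminorm_ge0 x : 0 <= q x.
Proof.
by have := sublinear_geN x (seminorm_sublinear semq); rewrite seminormN => ?; lra.
Qed.

Lemma sign_meanD n x y v w :
  sign_mean n (x + y) (v + w) <= sign_mean n x v + sign_mean n y w.
Proof.
elim: n x y => [|n IH] x y //=.
rewrite !fctE opprD ![x + y + _]addrACA.
have := IH (x + v n) (y + w n); have := IH (x - v n) (y - w n); lra.
Qed.

Lemma sign_meanZ n r x v :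
  sign_mean n (r *: x) (r *: v) = `|r| * sign_mean n x v.
Proof.
elim: n x => [|n IH] x /=; first exact: qZ.
by rewrite !fctE -scalerN -!scalerDr !IH -mulrDr mulrA.
Qed.

Lemma sign_mean_ge0 n x v : 0 <= sign_mean n x v.
Proof.
elim: n x => [|n IH] x /=; first exact: seminorm_ge0.
by rewrite divr_ge0// addr_ge0.
Qed.

(** In an l_1-like sequence no choice of signs produces cancellation.  The offset
    x, with its own share r of the lower bound, absorbs the terms whose signs have
    already been chosen. *)
Lemma sign_mean_ge n x r v (b : nat -> X) (t : nat -> R) :
    (forall i, v i = t i *: b i) ->
    (forall u : nat -> R,
      r + \sum_(i < n) `|u i| <= q (x + \sum_(i < n) u i *: b i)) ->
  r + \sum_(i < n) `|t i| <= sign_mean n x v.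
Proof.
move=> vE; elim: n x r => [|n IH] x r H /=.
  by have := H t; rewrite !big_ord0 !addr0.
have step s : `|s| = `|t n| ->
    r + `|t n| + \sum_(i < n) `|t i| <= sign_mean n (x + s *: b n) v.
  move=> st; apply: IH => u; pose u' i := if i == n then s else u i.
  have u'E (i : 'I_n) : u' i = u i by rewrite /u' ltn_eqF.
  have u'n : u' n = s by rewrite /u' eqxx.
  have := H u'; rewrite !big_ord_recr /= u'n st.
  rewrite (eq_bigr (fun i : 'I_n => `|u i|)) => [|i _]; last by rewrite u'E.
  rewrite (eq_bigr (fun i : 'I_n => u i *: b i)) => [|i _]; last by rewrite u'E.
  by rewrite [X in r + X]addrC addrA [X in x + X]addrC addrA.
have := step (t n) erefl; have := step (- t n) (normrN _).
rewrite scaleNr vE big_ord_recr /=; lra.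
Qed.

(** Along a single direction the mean square of s + sum_i eps_i c_i is
    s^2 + sum_i c_i^2: this is the orthogonality of the Rademacher functions, in
    the form of the parallelogram identity. *)
Lemma sign_mean_le n s (c : nat -> R) v y : (forall i, v i = c i *: y) ->
  sign_mean n (s *: y) v ^+ 2 <= (s ^+ 2 + \sum_(i < n) c i ^+ 2) * q y ^+ 2.
Proof.
move=> vE; elim: n s => [|n IH] s /=.
  by rewrite big_ord0 addr0 qZ exprMn real_normK ?num_real.
rewrite vE -scalerDl -scalerBl big_ord_recr /=.
have := IH (s + c n); have := IH (s - c n).
set A := sign_mean _ _ _; set B := sign_mean _ _ _; set S := \sum_(_ < _) _.
move=> A2 B2; have := sqr_ge0 (A - B); nra.
Qed.

End rademacher.

Section randomly_bounded.
Context (R : realType) (X : lmodType R) (q : X -> R) (semq : seminorm q).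
Implicit Types (x y : X) (v w : nat -> X) (r : R).

(** The largest domain on which the supremum of the sign means is a finite
    seminorm; it contains c_i x for every square-summable c.  Indexing the
    predicate by the proof [semq] lets the instances below be inferred. *)
Definition randomly_bounded of seminorm q : {pred nat -> X} :=
  mem [set v : nat -> X | exists M, forall n, sign_mean q n 0 v <= M].

Record rseq :=
  RSeq { rseq_val :> nat -> X; rseqP : rseq_val \in randomly_bounded semq }.

Lemma randomly_bounded_submod_closed : submod_closed (randomly_bounded semq).
Proof.
split.
  apply: mem_set; exists 0 => n.
  by have := sign_meanZ semq n 0 0 0; rewrite !scale0r normr0 mul0r => ->.
move=> a v w /set_mem[M vM] /set_mem[N wN]; apply: mem_set.
exists (`|a| * M + N) => n; have := sign_meanD semq n 0 0 (a *: v) w.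
rewrite addr0 => /le_trans; apply; apply: lerD => //.
have := sign_meanZ semq n a 0 v; rewrite scaler0 => ->.
exact: ler_wpM2l.
Qed.

HB.instance Definition _ :=
  GRing.isSubmodClosed.Build R (nat -> X) (randomly_bounded semq)
    randomly_bounded_submod_closed.
HB.instance Definition _ := [isSub for rseq_val].
HB.instance Definition _ := [Choice of rseq by <:].
HB.instance Definition _ := [SubChoice_isSubLmodule of rseq by <:].

Definition rnorm (v : rseq) : R := sup (range (fun n => sign_mean q n 0 v)).

Lemma rnorm_ge n (v : rseq) : sign_mean q n 0 v <= rnorm v.
Proof.
apply: ub_le_sup; last by exists n.
by have /set_mem[M vM] := rseqP v; exists M => _ [m _ <-].
Qed.

Lemma rnorm_le (v : rseq) M : (forall n, sign_mean q n 0 v <= M) -> rnorm v <= M.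
Proof.
by move=> vM; apply: ge_sup; [exists (sign_mean q 0 0 v); exists 0%N|move=> _ [m _ <-]].
Qed.

Lemma sublinear_rnorm : sublinear rnorm.
Proof.
split=> [v w|r v r0]; apply: rnorm_le => n /=.
  apply: le_trans (lerD (rnorm_ge n v) (rnorm_ge n w)).
  by have := sign_meanD semq n 0 0 v w; rewrite addr0.
have := sign_meanZ semq n r 0 v; rewrite scaler0 => ->.
by rewrite gtr0_norm// ler_pM2l// rnorm_ge.
Qed.

Lemma tensor_le (c : nat -> R) (S : R) x : (forall n, \sum_(i < n) c i ^+ 2 <= S) ->
  forall n, sign_mean q n 0 (fun i => c i *: x) <= Num.sqrt S * q x.
Proof.
move=> cS n; have S0 : 0 <= S by have := cS 0%N; rewrite big_ord0.
rewrite -(@ler_sqr _ _ _) ?nnegrE ?mulr_ge0 ?sqrtr_ge0 ?(seminorm_ge0 semq)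
  ?sign_mean_ge0//.
rewrite -[X in sign_mean q n X](scale0r x).
apply: le_trans (sign_mean_le semq n 0 (c := c) (fun=> erefl)) _.
by rewrite expr0n /= add0r exprMn sqr_sqrtr// ler_wpM2r ?sqr_ge0 ?cS.
Qed.

Lemma tensor_randomly_bounded (c : nat -> R) (S : R) x :
    (forall n, \sum_(i < n) c i ^+ 2 <= S) ->
  (fun i => c i *: x) \in randomly_bounded semq.
Proof.
by move=> cS; apply: mem_set; exists (Num.sqrt S * q x) => n; exact: tensor_le.
Qed.

Lemma unit_square_summable i n : \sum_(j < n) ((j == i :> nat)%:R : R) ^+ 2 <= 1.
Proof.
elim: n => [|n IH]; first by rewrite big_ord0.
rewrite big_ord_recr /=; have [->|ni] := eqVneq n i; last by rewrite expr0n addr0.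
rewrite big1 => [|j _]; first by rewrite add0r expr1n.
by rewrite (ltn_eqF (ltn_ord j)) expr0n.
Qed.

Definition single i x : rseq :=
  @RSeq (fun j => (j == i)%:R *: x)
    (tensor_randomly_bounded x (unit_square_summable i)).

Fact single_is_linear i : linear (single i).
Proof.
move=> r x y; apply/val_inj/funext => j /=.
by rewrite scalerDr !fctE /= !scalerA mulrC.
Qed.
HB.instance Definition _ i :=
  GRing.isLinear.Build R X rseq *:%R (single i) (single_is_linear i).

Lemma rnorm_tensor_le N (c : nat -> R) x :
  rnorm (\sum_(i < N) c i *: single i x) <= Num.sqrt (\sum_(i < N) c i ^+ 2) * q x.
Proof.
pose d i := if (i < N)%N then c i else 0.
have dS n : \sum_(i < n) d i ^+ 2 <= \sum_(i < N) c i ^+ 2.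
  have dN i : (N <= i)%N -> d i ^+ 2 = 0.
    by move=> Ni; rewrite /d ltnNge Ni expr0n.
  have [nN|/ltnW Nn] := leqP n N.
    rewrite -(big_mkord xpredT (fun i => c i ^+ 2)) (big_cat_nat (leq0n n) nN) //=.
    rewrite big_mkord.
    rewrite [X in X <= _](eq_bigr (fun i : 'I_n => c i ^+ 2)) => [|i _].
      by rewrite lerDl sumr_ge0// => i _; exact: sqr_ge0.
    by rewrite /d (leq_trans (ltn_ord i)).
  rewrite -(big_mkord xpredT (fun i => d i ^+ 2)) (big_cat_nat (leq0n N) Nn)//= big_mkord.
  rewrite [X in _ + X]big_nat_cond [X in _ + X]big1 ?addr0 => [|i]; last first.
    by rewrite andbT => /andP[/dN].
  by apply: ler_sum => i _; rewrite /d ltn_ord.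
apply: rnorm_le => n; have := tensor_le x dS n.
suff -> : (fun i => d i *: x) = \sum_(i < N) c i *: single i x by [].
apply/funext => j.
rewrite (big_morph (fun v : rseq => v j) (id1 := 0) (op1 := +%R))//.
rewrite (eq_bigr (fun i : 'I_N => c i *: ((j == i)%:R *: x)))//.
rewrite /d; have [jN|Nj] := ltnP j N.
  rewrite (bigD1 (Ordinal jN)) //= big1 => [|i].
    by rewrite addr0 eqxx scale1r.
  by rewrite -val_eqE /= eq_sym => /negbTE ->; rewrite scale0r scaler0.
rewrite scale0r big1// => i _.
by rewrite gtn_eqF ?scale0r ?scaler0// (leq_trans (ltn_ord i)).
Qed.


(** The functionals are the components f_i(x) = G(x at position i) of a single
    functional G on sequences.  Duality turns the bound
    sum_i c_i f_i(x) <= |c|_2 q(x), taken at c_i = f_i(x), into the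
    square-summability of the f_i(x). *)
Theorem extend_l2 (b : nat -> X) :
    (forall n (u : nat -> R), \sum_(i < n) `|u i| <= q (\sum_(i < n) u i *: b i)) ->
  exists2 f : nat -> {scalar X},
    forall N x, \sum_(i < N) f i x ^+ 2 <= q x ^+ 2 & forall i, 1 <= f i (b i).
Proof.
move=> qb.
pose C : set (rseq * R) := [set c : rseq * R | exists (t : nat -> R) N,
  (forall i, c.1 i = t i *: b i) /\ forall n, (N <= n)%N -> \sum_(i < n) t i = c.2].
have coneC : cone C.
  split.
  - exists (fun=> 0), 0%N; split=> [i|n _]; first by rewrite scale0r.
    by rewrite big1.
  - move=> c d [t [N [ct tN]]] [s [M [ds sM]]].
    exists (fun i => t i + s i), (maxn N M); split=> [i|n].
      by rewrite /= scalerDl -ct -ds.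
    by rewrite geq_max => /andP[/tN <- /sM <-]; rewrite big_split.
  - move=> r c _ [t [N [ct tN]]]; exists (fun i => r * t i), N; split=> [i|n].
      by rewrite /= -scalerA -ct.
    by move=> /tN <-; rewrite mulr_sumr.
have CP c : C c -> c.2 <= rnorm c.1.
  move=> [t [N [ct /(_ _ (leqnn N)) <-]]].
  apply: le_trans (rnorm_ge N c.1).
  apply: (@le_trans _ _ (0 + \sum_(i < N) `|t i|)).
    by rewrite add0r; apply: ler_sum => i _; exact: ler_norm.
  by apply: (sign_mean_ge (q := q) ct) => u; rewrite !add0r.
have [G [GP GC]] := hahn_banach_cone sublinear_rnorm coneC CP.
exists (fun i => G \o single i) => [N x|i].
  set S := \sum_(i < N) _.
  have S0 : 0 <= S by apply: sumr_ge0 => i _; exact: sqr_ge0.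
  (* The domination of G is tested at the coefficients c_i = f_i(x), for which
     both sum_i c_i f_i(x) and |c|_2 ^ 2 equal S. *)
  have : S <= Num.sqrt S * q x.
    apply: le_trans (rnorm_tensor_le N (fun i => G (single i x)) x).
    apply: le_trans (GP _); rewrite linear_sum /=.
    by apply: ler_sum => i _; rewrite linearZ.
  have q0 := seminorm_ge0 semq x.
  have := sqr_sqrtr S0; have := sqrtr_ge0 S; set s := Num.sqrt S; nra.
apply: (GC (single i (b i), 1)); exists (fun j => (j == i)%:R), i.+1.
split=> [j|n ltin] /=.
  by have [->|] := eqVneq j i; rewrite ?scale0r.
rewrite (bigD1 (Ordinal ltin)) //= eqxx big1 ?addr0// => j.
by rewrite -val_eqE /= => /negbTE ->.
Qed.

End randomly_bounded.

(** * Real functionals on real and complex spaces *)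

Section real_scalars.
Context (R : realType) (k : scalars).
Local Notation K := (scalar_field R k).

Lemma of_real1 : of_real k (1 : R) = 1.
Proof. by case: k. Qed.

Lemma of_realN (r : R) : of_real k (- r) = - of_real k r.
Proof. by case: k => //=; rewrite rmorphN. Qed.

Lemma of_realV (r : R) : of_real k r^-1 = (of_real k r)^-1.
Proof. by case: k => //=; rewrite fmorphV. Qed.

Lemma ltr_of_real (r s : R) : (of_real k r < of_real k s) = (r < s).
Proof. by rewrite !lt_neqAle ler_of_real (inj_eq (@of_real_inj R k)). Qed.

Lemma modulus_of_real (r : R) : modulus (of_real k r) = `|r|.
Proof.
apply: (@of_real_inj R k); rewrite of_real_modulus; have [r0|r0] := leP 0 r.
  by rewrite !ger0_norm// -(of_real0 R k) ler_of_real.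
rewrite !ltr0_norm//; first by rewrite of_realN.
by rewrite -(of_real0 R k) ltr_of_real.
Qed.

End real_scalars.

(** The underlying real vector space, on which Hahn-Banach is applied even when
    the scalars are complex. *)
Definition real_form (R : realType) (k : scalars)
  (M : lmodType (scalar_field R k)) : Type := M.

Section real_form.
Context (R : realType) (k : scalars) (M : lmodType (scalar_field R k)).

HB.instance Definition _ := GRing.Zmodule.on (real_form M).

Definition real_scale (r : R) (x : real_form M) : real_form M :=
  of_real k r *: (x : M).

Fact real_scaleA r s x : real_scale r (real_scale s x) = real_scale (r * s) x.
Proof. by rewrite /real_scale scalerA of_realM. Qed.

Fact real_scale1 : left_id 1 real_scale.
Proof. by move=> x; rewrite /real_scale of_real1 scale1r. Qed.

Fact real_scaleDr : right_distributive real_scale +%R.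
Proof. by move=> r x y; rewrite /real_scale scalerDr. Qed.

Fact real_scaleDl x : {morph real_scale^~ x : r s / r + s}.
Proof. by move=> r s; rewrite /real_scale of_realD scalerDl. Qed.

HB.instance Definition _ := GRing.Zmodule_isLmodule.Build R (real_form M)
  real_scaleA real_scale1 real_scaleDr real_scaleDl.

Lemma real_scaleE (r : R) (x : real_form M) :
  r *: x = (of_real k r *: (x : M)) :> M.
Proof. by []. Qed.

End real_form.

(** The value 0 over the reals makes the formula f(x) - i f(i x) for the
    complexification of f meaningful, and equal to f(x), in that case too. *)
Definition imaginary (R : realType) (k : scalars) : scalar_field R k :=
  match k return scalar_field R k with
  | Reals => 0
  | Complexes => 'i%C
  end.

(** Only the modulus of f(x) - i f(i x) is recorded: it is at least |f(x)|, and it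
    is square-summable along a family of functionals when the family is. *)
Lemma complexify (R : realType) (k : scalars)
    (M : lmodType (scalar_field R k)) (f : {scalar real_form M}) :
  exists g : {scalar M}, forall x,
    modulus (g x) ^+ 2 = f x ^+ 2 + f (imaginary R k *: (x : M)) ^+ 2.
Proof.
case: k M f => M f.
  have linf : scalar (f : M -> R) by move=> a x y; have := linearP f a x y.
  pose gL := GRing.isLinear.Build R M R *%R f linf.
  pose g : {scalar M} := HB.pack (f : M -> R) gL.
  exists g => x /=; rewrite scale0r [f (0 : M)](linear0 f) expr0n /= addr0.
  by rewrite real_normK ?num_real.
pose g0 (x : M) : R[i] := (f x +i* - f ('i%C *: x))%C.
have fZ (a b : R) (x : M) : f ((a +i* b)%C *: x) = a * f x + b * f ('i%C *: x).
  have -> : (a +i* b)%C *: x = ((a : R) *: (x : real_form M) +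
      b *: (('i%C *: x : M) : real_form M)).
    have -> : (a +i* b)%C = real_complex R a + real_complex R b * 'i%C.
      by apply/eqP; rewrite eq_complex /=; apply/andP; split; apply/eqP; ring.
    by rewrite scalerDl -scalerA.
  by rewrite linearD !linearZ.
have lin0 : scalar g0.
  move=> [a b] x y; rewrite /g0 scalerDr !(linearD f) scalerA (fZ a b).
  have -> : 'i%C * (a +i* b)%C = ((- b) +i* a)%C.
    by apply/eqP; rewrite eq_complex /=; apply/andP; split; apply/eqP; ring.
  rewrite (fZ (- b) a); apply/eqP; rewrite eq_complex /=.
  by apply/andP; split; apply/eqP; ring.
pose gL := GRing.isLinear.Build R[i] M R[i] *%R g0 lin0.
pose g : {scalar M} := HB.pack g0 gL.
exists g => x; rewrite /= sqr_sqrtr ?sqrrN//.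
by rewrite addr_ge0 ?sqr_ge0.
Qed.

(** * Continuous seminorms of a locally convex space *)

Section continuous_seminorms.
Context (R : realType) (k : scalars) (E : tvsType (scalar_field R k)).
Local Notation K := (scalar_field R k).
Implicit Types (q : real_form E -> R) (x y : real_form E).

Definition continuous_seminorm q :=
  seminorm q /\ forall e, 0 < e -> nbhs (0 : E) [set x | q x < e].

Lemma absorbing (V : set E) (x : E) : nbhs 0 V ->
  exists2 r : R, 0 < r & V (of_real k r *: x).
Proof.
move=> V0; have := @scale_continuous K E (0, x) V.
rewrite /= scale0r => /(_ V0)[[A B] /= [/nbhs_ballP[e /= e0 eA] Bx] AB].
have e0' : 0 < modulus e.
  by rewrite -(ltr_of_real k) of_real0 of_real_modulus normr_gt0 gt_eqF.
exists (modulus e / 2); first by rewrite divr_gt0.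
apply: (AB (_, x)); split => /=; last exact: nbhs_singleton.
apply: eA; rewrite -ball_normE /= sub0r normrN -of_real_modulus modulus_of_real.
rewrite -[X in _ < X](gtr0_norm e0) -of_real_modulus ltr_of_real gtr0_norm ?divr_gt0//.
lra.
Qed.

Lemma convex_nbhs_combination (V : set E) (a b : R) (x y : E) :
    convex_set V -> 0 <= a -> 0 <= b -> a + b = 1 -> V x -> V y ->
  V (of_real k a *: x + of_real k b *: y).
Proof.
move=> cV a0 b0 ab Vx Vy.
have b1 : b = 1 - a by rewrite -ab addrC addKr.
have Ka0 : 0 <= of_real k a by rewrite -(of_real0 R k) ler_of_real.
have Ka1 : of_real k a <= 1 by rewrite -(of_real1 R k) ler_of_real; lra.
have := cV x y (Itv01 Ka0 Ka1) (mem_set Vx) (mem_set Vy).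
by rewrite inE b1 of_realD of_realN of_real1.
Qed.

(** q is the Minkowski gauge of V = W /\ - W, where W is a convex open
    neighbourhood of 0 inside U.  V is symmetric but need not be balanced over
    the complex numbers, so that q is a seminorm for the real scalars only. *)
Lemma exists_seminorm (U : set E) : nbhs 0 U ->
  exists2 q, continuous_seminorm q & forall x, q x < 1 -> U x.
Proof.
move=> U0; have [B Bconv [Bopen Bnbhs]] := @locally_convex K E.
have [b [/= Bb b0] bU] := Bnbhs 0 _ U0.
have cb : convex_set b by apply: Bconv; rewrite inE.
have nb : nbhs (0 : E) b by apply: open_nbhs_nbhs; split=> //; exact: Bopen.
pose V := [set x : E | b x /\ b (- x)].
have nV : nbhs (0 : E) V.
  apply: filterI => //; have := nbhs0N nb.
  by apply: filterS => _ [x bx <-]; rewrite opprK.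
have V0 : V 0 by rewrite /V /= oppr0.
have cV (s t : R) (x y : E) : 0 <= s -> 0 <= t -> s + t = 1 -> V x -> V y ->
    V (of_real k s *: x + of_real k t *: y).
  move=> s0 t0 st [bx bx'] [by_ by']; split; first exact: convex_nbhs_combination.
  by rewrite opprD -!scalerN; exact: convex_nbhs_combination.
pose S (x : real_form E) := [set t : R | 0 < t /\ V (of_real k t^-1 *: (x : E))].
pose q x := inf (S x).
have Sne x : S x !=set0.
  have [r r0 Vr] := absorbing (x : E) nV; exists r^-1.
  by rewrite /S /= invrK invr_gt0.
have Slb x : has_lbound (S x) by exists 0 => t [/ltW].
have qS x t : S x t -> q x <= t by exact: ge_inf.
have q0 x : 0 <= q x by apply: lb_le_inf => // t [/ltW].
have qlt x e : q x < e -> exists2 t, S x t & t < e.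
  by move=> /(inf_lt (Sne x))[t St te]; exists t.
have SZ r x t : 0 < r -> S x t -> S (r *: x) (r * t).
  move=> r0 [t0 Vt]; split; first exact: mulr_gt0.
  rewrite real_scaleE scalerA -(of_realM k _ r) invfM mulrAC mulVf ?mul1r//.
  by rewrite gt_eqF.
have SD x y s t : S x s -> S y t -> S (x + y) (s + t).
  move=> [s0 Vs] [t0 Vt]; have st0 : 0 < s + t by exact: addr_gt0.
  split=> //.
  have := cV (s / (s + t)) (t / (s + t)) _ _ _ _ _ Vs Vt.
  rewrite !divr_ge0 ?ltW// -mulrDl divff ?gt_eqF// => /(_ isT isT erefl).
  rewrite !scalerA -(of_realM k (s / _)) -(of_realM k (t / _)).
  rewrite (mulrAC s) (mulrAC t) !mulfV ?gt_eqF// !mul1r.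
  by rewrite -scalerDr.
have SN x t : S x t -> S (- x) t.
  by move=> [t0 [b1 b2]]; split=> //; split; rewrite scalerN // opprK.
have qZle r x : 0 < r -> q (r *: x) <= r * q x.
  move=> r0; rewrite -ler_pdivrMl//; apply: lb_le_inf => // t St.
  by rewrite ler_pdivrMl//; apply: qS; exact: SZ.
have slq : sublinear q.
  split=> // x y; rewrite -lerBlDr; apply: lb_le_inf => // s Ss.
  rewrite lerBlDr -lerBlDl; apply: lb_le_inf => // t St.
  by rewrite lerBlDl; apply: qS; exact: SD.
have qN x : q (- x) = q x.
  suff h y : q (- y) <= q y by apply/le_anti; rewrite h -[X in q X <= _]opprK h.
  by apply: lb_le_inf => // t St; apply: qS; exact: SN.
exists q; first split.
- split=> [|r x]; first exact: (proj1 slq).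
  have [r0|r0] := leP 0 r; first by rewrite ger0_norm// sublinearZ.
  by rewrite ltr0_norm// -[in LHS](opprK r) scaleNr qN sublinearZ// oppr_ge0 ltW.
- move=> e e0; have e20 : of_real k (e / 2) != 0.
    by rewrite gt_eqF// -(of_real0 R k) ltr_of_real divr_gt0.
  apply: filterS (nbhs0Z e20 nV) => _ [x Vx <-].
  apply: (@le_lt_trans _ _ (e / 2)); last by lra.
  apply: qS; split; first by rewrite divr_gt0.
  by rewrite scalerA of_realV mulVf// scale1r.
- move=> x /qlt[t [t0 [Vt _]] t1]; apply: bU.
  have := @convex_nbhs_combination b t (1 - t) _ 0 cb _ _ _ Vt b0.
  rewrite scaler0 addr0 scalerA -(of_realM k t) mulfV ?gt_eqF// of_real1 scale1r.
  by apply; lra.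
Qed.

Lemma dominated_continuous (F : normedModType K) q (T : {linear E -> F}) :
    continuous_seminorm q -> (forall x : E, `|T x| <= of_real k (q x)) ->
  continuous T.
Proof.
move=> [_ qnbhs] Tq x; apply/cvgrPdist_lt => e e0.
have e0' : 0 < modulus e.
  by rewrite -(ltr_of_real k) of_real0 of_real_modulus normr_gt0 gt_eqF.
have := nbhsT x (qnbhs _ e0').
apply: filterS => _ [y /= qy <-]; rewrite -linearB opprD addNKr linearN normrN.
by apply: le_lt_trans (Tq y) _; rewrite -(gtr0_norm e0) -of_real_modulus ltr_of_real.
Qed.

(** With c the imaginary unit, this seminorm dominates both f(x) and f(i x)
    whenever q dominates f, hence also the complexification of f. *)
Lemma continuous_seminormD_scale q (c : K) : continuous_seminorm q ->
  continuous_seminorm (fun x => q x + q (c *: (x : E))).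
Proof.
move=> [[qD qZ] qnbhs]; split; first split.
- move=> x y; have := qD x y; have := qD (c *: (x : E)) (c *: (y : E)).
  by rewrite scalerDr; lra.
- move=> r x.
  have -> : c *: ((r *: x) : E) = (r *: (c *: (x : E) : real_form E)) :> real_form E.
    by rewrite !real_scaleE !scalerA mulrC.
  by rewrite !qZ mulrDr.
- move=> e e0; have e20 : 0 < e / 2 by rewrite divr_gt0.
  have nc : nbhs (0 : E) [set x | q (c *: x) < e / 2].
    have /= := @scale_continuous K E (c, 0) [set x | q x < e / 2].
    rewrite scaler0 => /(_ (qnbhs _ e20))[[A B] /= [nA nB] AB].
    apply: filterS nB => x Bx; apply: (AB (c, x)); split=> //=.
    exact: nbhs_singleton.
  apply: filterS (filterI (qnbhs _ e20) nc) => x /= [h1 h2]; lra.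
Qed.

End continuous_seminorms.

(** * Norms of scalar sequences *)

Section sequence_norms.
Context (R : realType) (k : scalars).
Local Notation K := (scalar_field R k).
Implicit Types (x : nat -> K^o) (M : R) (p : \bar R).

Let counting_nat_gt0 : (0 < @counting nat R [set: nat])%E.
Proof. by rewrite /counting asboolF//; exact: infinite_nat. Qed.

Lemma seq_norm_sum_le r n x : 1 <= r ->
  ((\sum_(i < n) modulus (x i) `^ r)%:E <= seq_norm r%:E x `^ r)%E.
Proof.
move=> r1; have r0 : 0 < r by lra.
rewrite /seq_norm Lnorm_counting// -poweRrM mulVf ?gt_eqF// poweRe1; last first.
  by apply: nneseries_ge0 => i _ _; exact: poweR_ge0.
rewrite -(big_mkord xpredT (fun i => modulus (x i) `^ r)) -sumEFin.
apply: le_trans (nneseries_lim_ge n _) => [|i _ _]; last exact: poweR_ge0.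
apply: lee_sum => i _.
by rewrite gee0_abs ?lee_fin ?modulus_ge0.
Qed.

Lemma modulus_le_seq_norm p n x : (1 <= p)%E ->
  ((modulus (x n))%:E <= seq_norm p x)%E.
Proof.
case: p => [r|_|//]; last first.
  rewrite /seq_norm unlock counting_nat_gt0.
  have /ess_supP : (ess_sup counting (abse \o (fun n => (modulus (x n))%:E)) <=
    ess_sup counting (abse \o (fun n => (modulus (x n))%:E)))%E by [].
  move=> [A [_ A0 xA]]; apply: contrapT => xn.
  have An : A n.
    by apply: xA => /= xn'; apply: xn; rewrite -{1}(ger0_norm (modulus_ge0 (x n))).
  have : (counting [set n] <= @counting nat R A)%E.
    by apply: le_measure; [exact: mem_set|exact: mem_set|move=> _ ->].
  by rewrite A0 /counting asboolT ?fset_set1// cardfs1 lee_fin ler10.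
rewrite lee_fin => r1; have r0 : 0 < r by lra.
have := seq_norm_sum_le n.+1 x r1; rewrite big_ord_recr /= => le_sum.
have {}le_sum : ((modulus (x n) `^ r)%:E <= seq_norm r%:E x `^ r)%E.
  apply: le_trans le_sum; rewrite lee_fin lerDr.
  by apply: sumr_ge0 => i _; exact: powR_ge0.
have : ((modulus (x n) `^ r)%:E `^ r^-1 <= (seq_norm r%:E x `^ r) `^ r^-1)%E.
  apply: gt0_ler_poweR => //; first by rewrite invr_ge0 ltW.
    by rewrite in_itv /= lee_fin powR_ge0 leey.
  by rewrite in_itv /= poweR_ge0 leey.
rewrite poweR_EFin -powRrM -poweRrM mulfV ?gt_eqF// powRr1 ?modulus_ge0//.
by rewrite poweRe1 // Lnorm_ge0.
Qed.

(** The contractive inclusion of l_2 into l_p for p >= 2: as each |x_i| is at most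
    M, |x_i|^p <= |x_i|^2 M^(p-2). *)
Lemma seq_norm_le_l2 p M x : (2%:E <= p)%E -> 0 <= M ->
    (forall n, \sum_(i < n) modulus (x i) ^+ 2 <= M ^+ 2) ->
  (seq_norm p x <= M%:E)%E.
Proof.
move=> p2 M0 xM.
have xnM n : modulus (x n) <= M.
  rewrite -(@ler_sqr _ _ _) ?nnegrE ?modulus_ge0//; apply: le_trans (xM n.+1).
  by rewrite big_ord_recr /= lerDr sumr_ge0// => i _; exact: sqr_ge0.
case: p p2 => [r||//]; last first.
  move=> _; rewrite /seq_norm unlock counting_nat_gt0.
  apply/ess_supP/nearW => n /=.
  by rewrite lee_fin ger0_norm ?modulus_ge0.
rewrite lee_fin => r2; have r0 : 0 < r by lra.
have powE a : 0 <= a -> a `^ r = a ^+ 2 * a `^ (r - 2).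
  move=> a0; rewrite -(powR_mulrn 2 a0) -powRD; first by rewrite addrC subrK.
  by rewrite addrC subrK gt_eqF.
have sumM : (\sum_(i <oo) `|(modulus (x i))%:E| `^ r <= (M `^ r)%:E)%E.
  apply: lime_le; first by apply: is_cvg_nneseries => i _ _; exact: poweR_ge0.
  apply: nearW => n; rewrite big_mkord.
  rewrite (eq_bigr (fun i : 'I_n => (modulus (x i) `^ r)%:E)); last first.
    by move=> i _; rewrite gee0_abs ?lee_fin ?modulus_ge0.
  rewrite sumEFin lee_fin powE//.
  apply: (@le_trans _ _ ((\sum_(i < n) modulus (x i) ^+ 2) * M `^ (r - 2))).
    rewrite mulr_suml; apply: ler_sum => i _; rewrite powE ?modulus_ge0//.
    rewrite ler_wpM2l ?sqr_ge0// ge0_ler_powR ?nnegrE ?modulus_ge0//; lra.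
  by rewrite ler_wpM2r ?powR_ge0.
rewrite /seq_norm Lnorm_counting//.
have -> : M%:E = ((M `^ r)%:E `^ r^-1)%E.
  by rewrite poweR_EFin -powRrM mulfV ?gt_eqF// powRr1.
apply: gt0_ler_poweR => //; first by rewrite invr_ge0 ltW.
  rewrite in_itv /= leey andbT; apply: nneseries_ge0 => i _ _.
  by rewrite lee_fin powR_ge0.
by rewrite in_itv /= lee_fin powR_ge0 leey.
Qed.

Lemma square_summable_small x M e : 0 < e ->
    (forall n, \sum_(i < n) modulus (x i) ^+ 2 <= M) ->
  \forall n \near \oo, modulus (x n) < e.
Proof.
move=> e0 xM; pose u n := modulus (x n) ^+ 2.
have cu : cvgn (series u).
  apply: nondecreasing_is_cvgn.
    by apply: nondecreasing_series => n _ _; exact: sqr_ge0.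
  by exists M => _ [n _ <-]; rewrite /series /= big_mkord.
have /cvgrPdist_lt/(_ _ (exprn_gt0 2 e0)) := cvg_series_cvg_0 cu.
apply: filterS => n; rewrite sub0r normrN ger0_norm ?sqr_ge0//.
by rewrite /u ltr_sqr ?nnegrE ?modulus_ge0// ltW.
Qed.

End sequence_norms.

(** * Coarse p-limited sets and diagonal sequences *)

Section square_summable_families.
Context (R : realType) (k : scalars) (E : tvsType (scalar_field R k)).
Local Notation K := (scalar_field R k).
Context (q : real_form E -> R) (G : nat -> {scalar E}).
Hypothesis contq : continuous_seminorm q.
Hypothesis Gq : forall n x, \sum_(i < n) modulus (G i x) ^+ 2 <= q x ^+ 2.

Lemma seq_norm_family p x : (2%:E <= p)%E ->
  (seq_norm p (fun n => G n x : K^o) <= (q x)%:E)%E.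
Proof.
by move=> p2; apply: seq_norm_le_l2 => // ; exact: seminorm_ge0 (proj1 contq) _.
Qed.

Lemma continuous_to_ell (p : \bar R) (p1 : (1 <= p)%E) : (2%:E <= p)%E ->
  exists2 T : {linear E -> ell k p1}, continuous T &
    forall x n, T x n = G n x.
Proof.
move=> p2.
have Gell x : (fun n => G n x : K^o) \in ellp p1.
  by rewrite inE; apply: le_lt_trans (seq_norm_family x p2) (ltry _).
pose T0 (x : E) : ell k p1 := Ell (Gell x).
have linT : linear T0.
  by move=> a x y; apply/val_inj/funext => n; rewrite /= linearP.
pose TL := GRing.isLinear.Build K E (ell k p1) *:%R T0 linT.
pose T : {linear E -> ell k p1} := HB.pack T0 TL.
exists T => //; apply: (dominated_continuous contq) => x.
rewrite ell_normE ler_of_real -lee_fin fineK; first exact: seq_norm_family.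
rewrite ge0_fin_numE ?Lnorm_ge0//; exact: seq_ofP.
Qed.

Lemma continuous_to_c0 :
  exists2 T : {linear E -> c0 R k}, continuous T &
    forall x n, (T x : ell k (leey 1%E)) n = G n x.
Proof.
have [T contT TG] := continuous_to_ell (leey 1%E) (leey _).
have Tnull x : T x \in @null_seq R k.
  apply: mem_set => /=; apply/cvgrPdist_lt => e e0.
  have e0' : 0 < modulus e.
    by rewrite -(ltr_of_real k) of_real0 of_real_modulus normr_gt0 gt_eqF.
  have := square_summable_small (x := G ^~ x) e0' (Gq ^~ x).
  apply: filterS => n Gn; rewrite sub0r normrN -of_real_modulus TG.
  by rewrite -[X in _ < X](gtr0_norm e0) -of_real_modulus ltr_of_real.
pose S0 (x : E) : c0 R k := C0 (Tnull x).
have linS : linear S0 by move=> a x y; apply/val_inj; rewrite /= linearP.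
pose SL := GRing.isLinear.Build K E (c0 R k) *:%R S0 linS.
pose S : {linear E -> c0 R k} := HB.pack S0 SL.
exists S => //; apply: (dominated_continuous contq) => x.
rewrite c0_normE ell_normE ler_of_real -lee_fin fineK.
  apply: le_trans (seq_norm_family x (leey _)).
  rewrite le_eqVlt; apply/orP; left; apply/eqP; congr seq_norm; apply/funext => n.
  exact: TG.
rewrite ge0_fin_numE ?Lnorm_ge0//; exact: seq_ofP.
Qed.

End square_summable_families.

Lemma precompact_cluster (K : numFieldType) (F : normedModType K) (S : set F)
    (t : nat -> F) : precompact S -> (forall n, S (t n)) ->
  exists s, forall e, 0 < e -> forall N, exists2 n, (N <= n)%N & `|s - t n| < e.
Proof.
rewrite precompactE => cS St.
have [|s [_ clus]] := cS (t @ \oo) _.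
  by exists 0%N => // n _; exact: subset_closure.
exists s => e e0 N.
have near_s : nbhs s [set y | `|s - y| < e].
  by apply/nbhs_ballP; exists e => //; rewrite -ball_normE.
have tail : (t @ \oo) (t @` [set n | (N <= n)%N]).
  by exists N => // n /= Nn; exists n.
by have [_ [[n Nn <-] ?]] := clus _ _ tail near_s; exists n.
Qed.

Section coarse_limited_sets.
Context (R : realType) (k : scalars) (E : tvsType (scalar_field R k)).
Local Notation K := (scalar_field R k).

(** Relative compactness gives points T(a_m) and T(a_n), with n as large as one
    wishes with respect to m, at distance less than 2/3.  The n-th coordinate of
    T(a_m) is less than 1/3 for n large, so that of T(a_n) is less than 1.  The
    space F stands for both l_p and c_0. *)
Lemma precompact_image_diagonal (F : normedModType K) (coord : F -> nat -> K)
    (T : E -> F) (G : nat -> E -> K) (a : nat -> E) (A : set E) M :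
    (forall y z n, of_real k (modulus (coord y n - coord z n)) <= `|y - z|) ->
    (forall x n, coord (T x) n = G n x) ->
    (forall x n, \sum_(i < n) modulus (G i x) ^+ 2 <= M x) ->
    precompact (T @` A) -> (forall n, A (a n)) ->
  exists n, modulus (G n (a n)) < 1.
Proof.
move=> lip TG GM preT Aa.
have [|s sP] := @precompact_cluster _ _ _ (T \o a) preT.
  by move=> n; exists (a n).
have e0 : 0 < of_real k (3^-1 : R) by rewrite -(of_real0 R k) ltr_of_real invr_gt0.
have [m _ sm] := sP _ e0 0%N.
have r0 : 0 < 3^-1 :> R by rewrite invr_gt0.
have [N _ GN] := square_summable_small (x := G ^~ (a m)) r0 (GM (a m)).
have [n Nn sn] := sP _ e0 N.
exists n; have Gm : modulus (G n (a m)) < 3^-1 by exact: GN.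
have dist : modulus (G n (a n) - G n (a m)) < 3^-1 + 3^-1.
  rewrite -!TG -(ltr_of_real k) of_realD.
  apply: le_lt_trans (lip _ _ _) _.
  have -> : T (a n) - T (a m) = (s - T (a m)) - (s - T (a n)).
    by rewrite opprB [RHS]addrC addrA subrK.
  by apply: le_lt_trans (ler_normB _ _) _; exact: ltrD.
have := modulusD (G n (a n) - G n (a m)) (G n (a m)).
rewrite subrK; lra.
Qed.

(** Complexifying f_i adds the term f_i(i x)^2 to f_i(x)^2, so q(x) + q(i x) takes
    over from q as the seminorm that makes the operator into l_p or c_0
    continuous. *)
Lemma coarse_limited_diagonal (p : \bar R) (p1 : (1 <= p)%E) (A : set E)
    (q : real_form E -> R) (f : nat -> {scalar real_form E}) (a : nat -> E) :
    (2%:E <= p)%E -> coarse_limited p1 A -> continuous_seminorm q ->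
    (forall n x, \sum_(i < n) f i x ^+ 2 <= q x ^+ 2) -> (forall n, A (a n)) ->
  exists n, f n (a n) < 1.
Proof.
move=> p2 [_ limA] contq fq Aa.
have /choice[G GE] := fun n => complexify (f n).
pose J : K := imaginary R k; pose Q (x : real_form E) := q x + q (J *: (x : E)).
have contQ : continuous_seminorm Q := continuous_seminormD_scale J contq.
have GQ n (x : E) : \sum_(i < n) modulus (G i x) ^+ 2 <= Q x ^+ 2.
  rewrite (eq_bigr _ (fun (i : 'I_n) _ => GE i x)) big_split /=.
  have := fq n x; have := fq n (J *: x).
  have := seminorm_ge0 (proj1 contq) x.
  have := seminorm_ge0 (proj1 contq) (J *: x).
  by rewrite /Q; nra.
have lip (r : \bar R) (r1 : (1 <= r)%E) (y z : ell k r1) n :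
    of_real k (modulus (y n - z n)) <= `|y - z|.
  rewrite ell_normE ler_of_real -lee_fin fineK.
    exact: (modulus_le_seq_norm n (y - z) r1).
  by rewrite ge0_fin_numE ?Lnorm_ge0//; exact: seq_ofP.
suff [n Gn] : exists n, modulus (G n (a n)) < 1.
  exists n; have := GE n (a n); have := sqr_ge0 (f n (imaginary R k *: a n)).
  have := modulus_ge0 (G n (a n)); nra.
move: limA; case: ifP => [/eqP poo|_] limA.
  have [T contT TG] := continuous_to_c0 contQ GQ.
  apply: (@precompact_image_diagonal (c0 R k)
    (fun y n => (y : ell k (leey 1%E)) n) T G a A (fun x => Q x ^+ 2)) => //.
  exact: limA.
have [T contT TG] := continuous_to_ell contQ GQ p1 p2.
apply: (@precompact_image_diagonal (ell k p1)
  (fun y n => y n) T G a A (fun x => Q x ^+ 2)) => //.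
exact: limA.
Qed.

End coarse_limited_sets.

(** * Boundedness, copies of the basis of l_1, and the theorem *)

Section main_steps.
Context (R : realType) (k : scalars) (E : tvsType (scalar_field R k)).
Local Notation K := (scalar_field R k).

Lemma sum_quarters n : \sum_(i < n) (2^-1 ^+ i.+1) ^+ 2 <= 1 :> R.
Proof.
suff : \sum_(i < n) (2^-1 ^+ i.+1) ^+ 2 <= 1 - (2^-1 ^+ n) ^+ 2 :> R.
  by move=> /le_trans; apply; rewrite gerBl sqr_ge0.
elim: n => [|n IH]; first by rewrite big_ord0 expr0 expr1n subrr.
rewrite big_ord_recr /= (exprSr _ n) exprMn; have := sqr_ge0 (2^-1 ^+ n : R).
set s := (_ ^+ n) ^+ 2 in IH *; have -> : (2^-1 : R) ^+ 2 = 4^-1.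
  by rewrite exprVn -natrX.
lra.
Qed.

(** A weakly bounded set is bounded, but here the dominated functionals that norm
    the points of an unbounded sequence contradict limitedness at once, without
    the uniform boundedness principle. *)
Lemma coarse_limited_bounded (p : \bar R) (p1 : (1 <= p)%E) (A : set E)
    (a : nat -> E) : (2%:E <= p)%E -> coarse_limited p1 A -> (forall n, A (a n)) ->
  tvs_bounded (range a).
Proof.
move=> p2 limA Aa U U0; have [q contq qU] := exists_seminorm U0.
have [qD qZ] := proj1 contq.
have [[M qM]|unb] := pselect (exists M, forall n, q (a n) < M).
  have M0 : 0 < M by apply: le_lt_trans (seminorm_ge0 (proj1 contq) (a 0%N)) (qM _).
  have KM0 : 0 < of_real k M by rewrite -(of_real0 R k) ltr_of_real.
  exists (of_real k M) => // _ [n _ <-] /=.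
  exists (of_real k M^-1 *: a n).
    apply: qU; rewrite -(real_scaleE M^-1 (a n : real_form E)) qZ.
    by rewrite gtr0_norm ?invr_gt0// ltr_pdivrMl// mulr1.
  by rewrite scalerA of_realV mulfV ?scale1r// gt_eqF.
exfalso.
have /choice[m qm] : forall n, exists m, 2 ^+ n.+1 <= q (a m).
  move=> n; apply: contrapT => nm; apply: unb; exists (2 ^+ n.+1) => m.
  by rewrite ltNge; apply/negP => h; apply: nm; exists m.
(* These weights make the functionals square-summable, as sum_n 4^-(n+1) <= 1,
   while q(a_(m n)) >= 2^(n+1) keeps their diagonal values at least 1. *)
pose c n : R := 2^-1 ^+ n.+1.
have c0 n : 0 < c n by rewrite exprn_gt0 ?invr_gt0.
have sl n : sublinear (fun x => c n * q x).
  have [slD slZ] := seminorm_sublinear (proj1 contq); split=> [x y|r x r0].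
    by rewrite -mulrDr ler_pM2l.
  by rewrite mulrCA ler_pM2l// slZ.
have /choice[f fP] := fun n => hahn_banach_point (a (m n) : real_form E) (sl n).
have [|n] := coarse_limited_diagonal (f := f) (a := a \o m) p2 limA contq _
    (fun n => Aa (m n)).
  move=> n x; apply: (@le_trans _ _ (\sum_(i < n) c i ^+ 2 * q x ^+ 2)).
    apply: ler_sum => i _; rewrite -exprMn -ler_sqrt ?sqr_ge0// !sqrtr_sqr.
    have := (fP i).1 x; have := (fP i).1 (- x).
    rewrite linearN (seminormN (proj1 contq)) => h1 h2.
    by rewrite (ler_norml (f i x)) ger0_norm; [apply/andP; split; lra|lra].
  by rewrite -mulr_suml ler_piMl ?sqr_ge0// sum_quarters.
rewrite ltNge /= (fP n).2 => /negP; apply.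
apply: le_trans (ler_wpM2l (ltW (c0 n)) (qm n)).
by rewrite /c exprVn mulVf// expf_neq0.
Qed.

(** Continuity of the isomorphism f onto the copy of l_1 bounds |f(x)|_1 by a
    continuous seminorm of E on the span of b, and |f(x)|_1 is the l_1-norm of the
    coefficients of x. *)
Lemma ell1_basis_lower_bound (b : nat -> E) : equiv_ell1_basis b ->
  exists2 q : real_form E -> R, continuous_seminorm q &
    forall n (u : nat -> R),
      \sum_(i < n) `|u i| <= q (\sum_(i < n) u i *: (b i : real_form E)).
Proof.
move=> [f [flin fcont _] fb]; set S := closure (seq_span b) in flin fcont.
have Sspan n (c : nat -> K) : S (\sum_(i < n) c i *: b i).
  by apply: subset_closure; exists n, c.
have S0 : S 0 by have := Sspan 0%N (fun=> 0); rewrite big_ord0.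
have Sb n : S (b n).
  have := Sspan n.+1 (fun i => (i == n)%:R); rewrite big_ord_recr /= eqxx scale1r.
  by rewrite big1 ?add0r// => i _; rewrite (ltn_eqF (ltn_ord i)) scale0r.
have f0 : f 0 = 0.
  have := flin 1 _ _ S0 S0; rewrite !scale1r addr0 => /esym/eqP.
  by rewrite -subr_eq0 addrK => /eqP.
have fsum n (c : nat -> K) m :
    f (\sum_(i < n) c i *: b i) m = if (m < n)%N then c m else 0.
  elim: n => [|n IH]; first by rewrite big_ord0 f0.
  rewrite big_ord_recr /= addrC flin; [|exact: Sb|exact: (Sspan n c)].
  have -> (y z : ell k (lexx (1%:E : \bar R))) : (c n *: y + z) m = c n * y m + z m.
    by [].
  rewrite IH fb ltnS (leq_eqVlt m n).
  have [->|mn] := eqVneq m n; first by rewrite ltnn addr0 mulr1.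
  by rewrite mulr0 add0r.
have [U U0 fU] : exists2 U, nbhs (0 : E) U & forall x, U x -> S x -> `|f x| < 1.
  have nf0 : f @ within S (nbhs 0) --> f 0 := (subspace_continuousP _ f).1 fcont 0 S0.
  have := nf0; rewrite f0 => /cvgrPdist_lt/(_ _ ltr01) nf.
  exists [set x | S x -> `|f x| < 1] => [|x +]; last exact.
  by apply: filterS nf => x /=; rewrite sub0r normrN.
have [q contq qU] := exists_seminorm U0; exists q => // n u.
have [_ qZ] := proj1 contq.
pose c i := of_real k (u i); set x : E := \sum_(i < n) c i *: b i.
rewrite -[X in q X]/x.
have Sx : S x by exact: Sspan.
pose s := fine (seq_norm 1%:E (f x)).
have sE : s%:E = seq_norm 1%:E (f x).
  rewrite fineK// ge0_fin_numE ?Lnorm_ge0//; exact: (seq_ofP (f x)).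
have s0 : 0 <= s by rewrite -lee_fin sE Lnorm_ge0.
apply: (@le_trans _ _ s).
  rewrite -lee_fin sE.
  have := seq_norm_sum_le n (f x) (lexx 1); rewrite poweRe1 ?Lnorm_ge0//.
  apply: le_trans; rewrite lee_fin; apply: ler_sum => i _.
  by rewrite fsum ltn_ord powRr1 ?modulus_ge0// modulus_of_real.
(* If q(x) < s = |f(x)|_1, the rescaled vector x / s lies in U although its image
   has norm 1. *)
rewrite leNgt; apply/negP => qs; have {}s0 : 0 < s.
  by apply: le_lt_trans qs; exact: seminorm_ge0 (proj1 contq) _.
have Ssx : S (of_real k s^-1 *: x).
  rewrite /x scaler_sumr (eq_bigr (fun i : 'I_n => (of_real k s^-1 * c i) *: b i)).
    exact: (Sspan n (fun i => of_real k s^-1 * c i)).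
  by move=> i _; rewrite scalerA.
have Usx : U (of_real k s^-1 *: x).
  apply: qU; rewrite -(real_scaleE s^-1 (x : real_form E)) qZ.
  by rewrite gtr0_norm ?invr_gt0// ltr_pdivrMl// mulr1.
have fsx : f (of_real k s^-1 *: x) = of_real k s^-1 *: f x.
  by rewrite -[of_real k s^-1 *: x]addr0 flin// f0 addr0.
have := fU _ Usx Ssx; rewrite fsx normrZ ell_normE -/s -of_real_modulus.
rewrite modulus_of_real -of_realM -(of_real1 R k) ltr_of_real.
by rewrite gtr0_norm ?invr_gt0// mulVf ?gt_eqF// ltxx.
Qed.

End main_steps.

Theorem theorem5p21 (R : realType) (k : scalars)
    (E : tvsType (scalar_field R k)) (hausE : hausdorff_space E)
    (p : \bar R) (p2 : (2%:E <= p)%E) (rosE : rosenthal_property E)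
    (A : set E) (limA : coarse_limited (ge1_of_ge2 p2) A) :
  weakly_sequentially_precompact A.
Proof.
move=> a Aa.
have [b [phi phi_mono bE] []] := rosE a (coarse_limited_bounded p2 limA Aa).
  by exists b => //; exists phi.
move=> /ell1_basis_lower_bound[q contq qb]; exfalso.
have [f fq fb] := extend_l2 (proj1 contq) qb.
have Ab n : A (b n) by rewrite bE; exact: Aa.
have [n] := coarse_limited_diagonal p2 limA contq fq Ab.
by rewrite ltNge fb.
Qed.
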